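(* Consider the single-attribute setting of Nash nearest neighbor search (NaNNS) described in the context. Given any query $q \in \mathbb{R}^d$ and an exact oracle ENN which, for any set $D$ and query $q$, returns the $k$ vectors of $D$ most similar to $q$, the algorithm Nash-ANN (using ENN in its fetching step) returns a size-$k$ subset $\textsc{Alg} \subseteq P$ satisfying $$\textsc{Alg} \in \arg\max_{S \subseteq P:\ |S| = k} \mathrm{NSW}(S).$$ Furthermore, the algorithm runs in time $O(kc) + \sum_{\ell=1}^c \mathrm{ENN}(D_\ell, q)$, where $\mathrm{ENN}(D_\ell,q)$ is the time required by the exact oracle to find the $k$ most similar vectors to $q$ in $D_\ell$.
   Context: Setting: $P \subset \mathbb{R}^d$ is a finite set of input vectors, $\sigma: \mathbb{R}^d \times \mathbb{R}^d \to \mathbb{R}_{\ge 0}$ is a similarity function, $k$ is a positive integer, and there are $c$ attributes $[c]=\{1,\dots,c\}$. Each $v \in P$ has a nonempty set of attributes $\mathrm{atb}(v) \subseteq [c]$, and $D_\ell = \{v \in P : \ell \in \mathrm{atb}(v)\}$. In the single-attribute setting, $|\mathrm{atb}(v)| = 1$ for every $v\in P$, so the $D_\ell$ partition $P$. For a query $q$ and $S \subseteq P$, the utility of attribute $\ell$ is $u_\ell(S) = \sum_{v \in S \cap D_\ell} \sigma(q,v)$. With a fixed smoothing constant $\eta > 0$, the Nash social welfare is $\mathrm{NSW}(S) = \big(\prod_{\ell=1}^c (u_\ell(S)+\eta)\big)^{1/c}$. NaNNS asks for $\arg\max_{S\subseteq P, |S|=k} \mathrm{NSW}(S)$. Algorithm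 Nash-ANN: (1) For each $\ell \in [c]$, fetch via the oracle a set $\widehat D_\ell \subseteq D_\ell$ of $k$ nearest neighbors of $q$ in $D_\ell$; let $v^\ell_{(i)}$ denote the $i$-th most similar vector to $q$ in $\widehat D_\ell$. (2) Initialize $\textsc{Alg} = \emptyset$, and $k_\ell = 0$, $w_\ell = 0$ for each $\ell$. (3) While $|\textsc{Alg}| < k$: choose $a \in \arg\max_{\ell \in [c]} \big(\log(w_\ell + \eta + \sigma(q, v^\ell_{(k_\ell+1)})) - \log(w_\ell+\eta)\big)$ (ties broken arbitrarily), add $v^a_{(k_a+1)}$ to $\textsc{Alg}$, set $w_a \leftarrow w_a + \sigma(q, v^a_{(k_a+1)})$ and $k_a \leftarrow k_a+1$. (4) Return $\textsc{Alg}$. *)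

(* Defs.v *)
From mathcomp Require Export all_boot all_order all_algebra finmap.
From mathcomp Require Export reals exp.
Set Implicit Arguments.
Unset Strict Implicit.
Unset Printing Implicit Defensive.
Import Order.TTheory GRing.Theory Num.Theory.
Local Open Scope fset_scope.
Local Open Scope ring_scope.

Section Problem.
Context {R : realType} {d c : nat}.
Notation vec := 'rV[R]_d.
Implicit Types (P S D : {fset vec}) (q : vec).

Definition attr_class P (atb : vec -> {set 'I_c}) (l : 'I_c) : {fset vec} :=
  [fset v in P | l \in atb v].

Definition single_attribute P (atb : vec -> {set 'I_c}) : Prop :=
  forall v, v \in P -> #|atb v| = 1%N.

Definition utility (sigma : vec -> vec -> R) P atb q S (l : 'I_c) : R :=
  \sum_(v <- S `&` attr_class P atb l) sigma q v.

Definition NSW (sigma : vec -> vec -> R) (eta : R) P atb q S : R :=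
  (\prod_(l < c) (utility sigma P atb q S l + eta)) `^ (c%:R^-1).

Definition in_argmax (k : nat) P (f : {fset vec} -> R) S : Prop :=
  [/\ S `<=` P, #|` S| = k &
      forall S', S' `<=` P -> #|` S'| = k -> f S' <= f S].

(* The answer is ranked: its i-th entry (from 0) is the (i+1)-st most similar
   vector, with ties in similarity ordered arbitrarily. When D has fewer than
   k elements, the answer consists of all of them. *)
Definition exact_oracle (sigma : vec -> vec -> R) (k : nat)
    (ENN : {fset vec} -> vec -> seq vec) : Prop :=
  forall D q,
    [/\ uniq (ENN D q),
        {subset ENN D q <= D},
        size (ENN D q) = minn k #|` D|,
        sorted (fun x y => sigma q y <= sigma q x) (ENN D q) &
        forall x y, x \in ENN D q -> y \in D -> y \notin ENN D q ->
          sigma q y <= sigma q x].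

End Problem.

(* Cost model: a computation is a result together with the number of
   elementary operations spent. The elementary operations, of unit cost, are
   those of a real RAM (array access, arithmetic, comparison and logarithm of
   reals), evaluation of sigma, and insertion in and cardinality of the output
   set (an array with a counter, as no vector is inserted twice when the
   attribute classes are disjoint). Everything inside a [tick] is one such
   operation on values already computed. *)

Definition timed (A : Type) : Type := (A * nat)%type.

Definition ret {A} (x : A) : timed A := (x, 0%N).

Definition tick {A} (x : A) : timed A := (x, 1%N).

Definition bind {A B} (m : timed A) (f : A -> timed B) : timed B :=
  ((f m.1).1, (m.2 + (f m.1).2)%N).

Notation "'let!' x ':=' m 'in' e" := (bind m (fun x => e))
  (at level 200, x name, m at level 200, e at level 200,
   format "'[v' 'let!'  x  ':='  m  'in' '/' e ']'").

(* Each turn of the loop is charged one operation besides those of its body. *)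
Fixpoint for_each {A B} (s : seq B) (body : B -> A -> timed A) (a : A) :
    timed A :=
  if s is x :: s' then
    let! _ := tick tt in
    let! a' := body x a in
    for_each s' body a'
  else ret a.

(* [while_run guard body s s' t]: the loop started in state s terminates, in
   state s' and after t operations; no s', t exist if the loop diverges. *)
Inductive while_run {A} (guard : A -> timed bool) (body : A -> timed A) :
    A -> A -> nat -> Prop :=
| While_stop s : (guard s).1 = false -> while_run guard body s s (guard s).2
| While_step s s' t : (guard s).1 = true ->
    while_run guard body (body s).1 s' t ->
    while_run guard body s s' ((guard s).2 + (body s).2 + t)%N.

Definition alloc {c : nat} {T : Type} (x : T) : timed {ffun 'I_c -> T} :=
  ([ffun=> x], c).

Definition upd {c : nat} {T : Type} (a : {ffun 'I_c -> T}) (i : 'I_c) (x : T) :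
    {ffun 'I_c -> T} := [ffun j => if j == i then x else a j].

Record state (R : realType) (d c : nat) := State {
  alg : {fset 'rV[R]_d};
  cnt : {ffun 'I_c -> nat};      (* k_l *)
  wel : {ffun 'I_c -> R}         (* w_l *)
}.

Section NashANN.
Context {R : realType} {d c : nat}.
Notation vec := 'rV[R]_d.
Variables (sigma : vec -> vec -> R) (eta : R) (k : nat).
Variables (P : {fset vec}) (atb : vec -> {set 'I_c}) (q : vec).
(* The oracle, and the time it takes on a given set and query. *)
Variables (ENN : {fset vec} -> vec -> seq vec) (tENN : {fset vec} -> vec -> nat).
(* The tie-breaking rule. In a scan of the attributes, [tie st b l] decides
   whether l replaces the current best b when both have the same gain; as it
   is arbitrary and sees the whole state, every maximizer may be selected in
   every iteration. *)
Variable tie : state R d c -> 'I_c -> 'I_c -> bool.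

Definition oracle_call (D : {fset vec}) : timed (seq vec) :=
  (ENN D q, tENN D q).

Definition fetch : timed {ffun 'I_c -> seq vec} :=
  let! Dhat := alloc [::] in
  for_each (enum 'I_c)
    (fun l Dh => let! s := oracle_call (attr_class P atb l) in
                 tick (upd Dh l s))
    Dhat.

Definition init : timed (state R d c) :=
  let! A := tick fset0 in
  let! kl := alloc 0%N in
  let! wl := alloc 0 in
  ret (State A kl wl).

Definition guard (st : state R d c) : timed bool :=
  let! n := tick #|` alg st| in
  tick (n < k)%N.

Section Iteration.
Variable Dhat : {ffun 'I_c -> seq vec}.

(* Whether v^l_(k_l + 1) exists; false only if D_l has fewer than k elements,
   all of which have been selected. *)
Definition available (st : state R d c) (l : 'I_c) : timed bool :=
  let! i := tick (cnt st l) in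
  let! s := tick (Dhat l) in
  let! n := tick (size s) in
  tick (i < n)%N.

Definition next_vector (st : state R d c) (l : 'I_c) : timed vec :=
  let! i := tick (cnt st l) in
  let! s := tick (Dhat l) in
  tick (nth 0 s i).

Definition gain (st : state R d c) (l : 'I_c) : timed R :=
  let! v := next_vector st l in
  let! x := tick (sigma q v) in
  let! w := tick (wel st l) in
  let! w0 := tick (w + eta) in
  let! w1 := tick (w0 + x) in
  let! y1 := tick (ln w1) in
  let! y0 := tick (ln w0) in
  tick (y1 - y0).

(* None if no attribute is available. *)
Definition choose_attr (st : state R d c) : timed (option ('I_c * R)) :=
  for_each (enum 'I_c)
    (fun l best =>
       let! ok := available st l in
       if ok then
         let! g := gain st l in
         match best with
         | None => tick (Some (l, g))
         | Some (b, gb) =>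
             let! better := tick (gb < g) in
             let! equal := tick (g == gb) in
             let! replace := tick (tie st b l) in
             tick (if better || (equal && replace) then Some (l, g)
                   else Some (b, gb))
         end
       else ret best)
    None.

(* If no attribute is available the state is unchanged, so that the loop
   diverges. *)
Definition body (st : state R d c) : timed (state R d c) :=
  let! best := choose_attr st in
  if best is Some (a, _) then
    let! v := next_vector st a in
    let! A := tick (v |` alg st) in
    let! x := tick (sigma q v) in
    let! w := tick (wel st a) in
    let! w' := tick (w + x) in
    let! wl := tick (upd (wel st) a w') in
    let! i := tick (cnt st a) in
    let! i' := tick i.+1 in
    let! kl := tick (upd (cnt st) a i') in
    ret (State A kl wl)
  else ret st.

End Iteration.

(* [nash_ann A t]: the algorithm halts, returning A after t operations. *)
Definition nash_ann (A : {fset vec}) (t : nat) : Prop :=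
  exists (st : state R d c) (t' : nat),
    [/\ while_run guard (body fetch.1) init.1 st t',
        A = alg st &
        t = (fetch.2 + init.2 + t')%N].

End NashANN.

(* Main.v *)
(* Maximizing the welfare amounts to distributing k picks over the attributes:
   the best utility with j picks of attribute l is that of the j most similar
   vectors of D_l, and its logarithm is concave in j. The greedy counts admit a
   price z that separates the marginal log-gains of the selected vectors from
   those of the remaining ones. By concavity, passing from the greedy counts k_l
   to other counts m_l changes the log-welfare by at most
   sum_l z (m_l - k_l) = z (k - k) = 0. *)

From mathcomp Require Import sequences lra zify.
Require Import Defs.
Import Order.TTheory GRing.Theory Num.Theory.
Local Open Scope fset_scope.
Local Open Scope ring_scope.

Set Implicit Arguments.
Unset Strict Implicit.

(** * Exchange inequalities, concavity, and counting by attribute *)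

(** As the sizes agree, [z] may be subtracted from every term. The common elements then cancel, the
    rest of [s] contributes at most 0 and the rest of [t] at least 0. *)
Lemma ler_sum_threshold (R : realDomainType) (T : eqType) (f : T -> R)
    (s t : seq T) (z : R) :
  uniq s -> uniq t -> size s = size t ->
  {in t, forall x, z <= f x} ->
  {in s, forall x, x \notin t -> f x <= z} ->
  \sum_(x <- s) f x <= \sum_(x <- t) f x.
Proof.
move=> us ut st zt sz.
have shift (r : seq T) : \sum_(x <- r) f x =
    \sum_(x <- r) (f x - z) + z *+ size r.
  rewrite -count_predT -iter_addr_0 -big_const_seq -big_split /=.
  by apply: eq_bigr => x _; rewrite subrK.
rewrite !shift st lerD2r.
rewrite (bigID (mem t)) [leRHS](bigID (mem s)) /= -[leLHS]addr0.
have le0 : \sum_(x <- s | x \notin t) (f x - z) <= 0.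
  rewrite big_seq_cond; apply: sumr_le0 => x /andP[xs xt].
  by rewrite subr_le0 sz.
have ge0 : 0 <= \sum_(x <- t | x \notin s) (f x - z).
  rewrite big_seq_cond; apply: sumr_ge0 => x /andP[xt _].
  by rewrite subr_ge0 zt.
rewrite addr0; apply: lerD (le_trans le0 ge0).
rewrite -big_filter -[leRHS]big_filter le_eqVlt; apply/orP; left; apply/eqP.
apply: perm_big; apply: uniq_perm; rewrite ?filter_uniq // => x.
by rewrite !mem_filter andbC.
Qed.

(** A number between the increments before and after [i] is a supergradient of the concave [G] at
    [i]: the line of slope [z] through [(i, G i)] stays above [G] on [[0, n]]. At the ends 0 and [n]
    one of the two increments is missing, hence the guarded hypotheses. *)
Lemma increment_threshold (R : realDomainType) (G : nat -> R) (n i j : nat)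
    (z : R) :
  (forall h, (h.+1 < n)%N -> G h.+2 - G h.+1 <= G h.+1 - G h) ->
  (i <= n)%N -> (j <= n)%N ->
  ((0 < i)%N -> z <= G i - G i.-1) ->
  ((i < n)%N -> G i.+1 - G i <= z) ->
  G j - G i <= z *+ j - z *+ i.
Proof.
move=> concave le_in le_jn zi iz.
have [le_ij|lt_ji] := leqP i j.
  have up h : (i + h < n)%N -> G (i + h).+1 - G (i + h)%N <= z.
    elim: h => [|h IH] lt_n; first by rewrite addn0 iz // -[i]addn0.
    rewrite addnS in lt_n *.
    exact: le_trans (concave _ lt_n) (IH (ltnW lt_n)).
  rewrite -mulrnBr // -(subnKC le_ij) addKn in le_jn *.
  elim: (j - i)%N le_jn => [|h IH] le_n; first by rewrite addn0 subrr mulr0n.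
  rewrite addnS in le_n *.
  have := lerD (up _ le_n) (IH (ltnW le_n)).
  by rewrite addrA subrK mulrS.
(* Concavity carries the bound on the last increment before [i] to all earlier ones; [h < i] keeps
   the subtraction from truncating. *)
have down h : (h < i)%N -> z <= G (i - h)%N - G (i - h).-1.
  elim: h => [|h IH] lt_h; first by rewrite subn0 zi.
  apply: le_trans (IH (ltnW lt_h)) _.
  have -> : (i - h = (i - h.+1).-1.+2)%N by lia.
  have -> : (i - h.+1 = (i - h.+1).-1.+1)%N by lia.
  by apply: concave; lia.
rewrite -opprB lerNl opprB -mulrnBr ?(ltnW lt_ji) //.
rewrite -[in G j](subKn (ltnW lt_ji)); have := leq_subr j i.
elim: (i - j)%N => [|h IH] le_h; first by rewrite subn0 subrr mulr0n.
rewrite subnS.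
have := lerD (down _ le_h) (IH (ltnW le_h)).
by rewrite mulrS [X in _ <= X -> _]addrC addrA subrK.
Qed.

Lemma ln_increment_le (R : realType) (a x y : R) :
  0 < a -> 0 <= y -> y <= x ->
  ln (a + x + y) - ln (a + x) <= ln (a + x) - ln a.
Proof.
move=> a0 y0 yx.
have ax0 : 0 < a + x by lra.
have axy0 : 0 < a + x + y by lra.
rewrite lerBrDr addrAC lerBlDr -!lnM ?posrE //.
rewrite ler_ln ?posrE ?mulr_gt0 //.
(* The goal is [a (a + x + y) <= (a + x)^2], whose sides differ by [a (x - y) + x^2]. *)
by nra.
Qed.

Lemma card_attr_classes (R : realType) (d c : nat) (P S : {fset 'rV[R]_d})
    (atb : 'rV[R]_d -> {set 'I_c}) :
  single_attribute P atb -> S `<=` P ->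
  #|` S| = (\sum_(l < c) #|` S `&` attr_class P atb l|)%N.
Proof.
move=> single /fsubsetP SP.
have card_class l :
    #|` S `&` attr_class P atb l| = (\sum_(v <- S) (l \in atb v))%N.
  rewrite -big_mkcond /= sum1_count -size_filter.
  apply: perm_size; apply: uniq_perm; rewrite ?filter_uniq ?fset_uniq // => v.
  rewrite mem_filter !inE andbC.
  by case: (boolP (v \in S)) => [/SP ->|]; rewrite ?andbT ?andbF.
(* Double counting: after the exchange, each [v] contributes the cardinality of [atb v], which is
   1. *)
rewrite (eq_bigr _ (fun l _ => card_class l)) exchange_big /= card_fset_sum1.
apply: eq_big_seq => v vS.
by rewrite -big_mkcond sum1_card single ?SP.
Qed.

(** * Value and cost of bounded loops *)

Lemma for_each_value (A B : Type) (s : seq B) (f : B -> A -> timed A) (a : A) :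
  (for_each s f a).1 = foldl (fun a x => (f x a).1) a s.
Proof. by elim: s a => //= x s IH a; rewrite IH. Qed.

(** The bound [T x] must hold in every loop state; the successor pays the charge for the turn
    itself. *)
Lemma for_each_cost (A B : Type) (s : seq B) (f : B -> A -> timed A)
    (T : B -> nat) (a : A) :
  (forall x a, (f x a).2 <= T x)%N ->
  ((for_each s f a).2 <= \sum_(x <- s) (T x).+1)%N.
Proof.
move=> fT; elim: s a => [|x s IH] a /=; first by rewrite big_nil.
rewrite big_cons; have := fT x a; have := IH (f x a).1; lia.
Qed.

Lemma foldl_upd (c : nat) (T : Type) (g : 'I_c -> T) (s : seq 'I_c)
    (a : {ffun 'I_c -> T}) (l : 'I_c) :
  foldl (fun b i => upd b i (g i)) a s l = if l \in s then g l else a l.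
Proof.
elim/last_ind: s => [|s i IH] //=.
by rewrite foldl_rcons ffunE mem_rcons inE IH; case: eqP => [->|].
Qed.

(** * The scan for an attribute of largest gain *)

Section Choice.
Context {R : realType} {d c : nat}.
Variables (sigma : 'rV[R]_d -> 'rV[R]_d -> R) (eta : R) (q : 'rV[R]_d).
Variables (tie : state R d c -> 'I_c -> 'I_c -> bool).
Variables (Dhat : {ffun 'I_c -> seq 'rV[R]_d}) (st : state R d c).

Local Notation avail l := (available Dhat st l).1.
Local Notation gain_of l := (gain sigma eta q Dhat st l).1.
Local Notation choice := (choose_attr sigma eta q tie Dhat st).

Lemma choose_attr_spec :
  match choice.1 with
  | None => forall l, ~~ avail l
  | Some (a, _) => avail a /\ forall l, avail l -> gain_of l <= gain_of a
  end.
Proof.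
(* Strengthened for induction over the scanned prefix: the stored number has to be the gain of the
   stored attribute, since later comparisons use only that number. *)
suff: match choice.1 with
      | None => {in enum 'I_c, forall l, ~~ avail l}
      | Some (a, g) => [/\ avail a, g = gain_of a &
          {in enum 'I_c, forall l, avail l -> gain_of l <= g}]
      end.
  case: choice.1 => [[a _] [ok -> le_g]|no].
    by split=> // l; apply: le_g; rewrite mem_enum.
  by move=> l; apply: no; rewrite mem_enum.
pose pick best l :=
  if avail l then
    if best is Some (b, gb) then
      if (gb < gain_of l) || (gain_of l == gb) && tie st b l
      then Some (l, gain_of l) else Some (b, gb)
    else Some (l, gain_of l)
  else best.
have -> : choice.1 = foldl pick None (enum 'I_c).
  rewrite /choose_attr for_each_value; elim: (enum 'I_c) None => //= l s IH best.
  rewrite -IH /pick /=; congr (foldl _ _ s).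
  by case: ifP => // _; case: best => [[b gb]|].
elim/last_ind: (enum 'I_c) => [|s i IH] //.
rewrite foldl_rcons {1}/pick; move: IH.
case: (foldl pick None s) => [[b gb] [ok -> le_s]|no_s].
  case: ifP => [ok_i|no_i]; last first.
    by split=> // l; rewrite mem_rcons inE => /predU1P[->|/le_s//]; rewrite no_i.
  (* Whichever way a tie is resolved, the survivor's gain is at least the other's. *)
  case: ifPn => [better|].
    have le_bi : gain_of b <= gain_of i.
      by case/orP: better => [/ltW|/andP[/eqP ->]].
    split=> // l; rewrite mem_rcons inE => /predU1P[->//|/le_s le_b] /le_b.
    by move=> /le_trans; apply.
  rewrite negb_or -leNgt => /andP[le_ib _].
  by split=> // l; rewrite mem_rcons inE => /predU1P[->//|/le_s].
case: ifP => [ok_i|no_i].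
  split=> // l; rewrite mem_rcons inE => /predU1P[->//|/no_s no_l ok_l].
  by rewrite ok_l in no_l.
by move=> l; rewrite mem_rcons inE => /predU1P[->|/no_s//]; rewrite no_i.
Qed.

Lemma choose_attr_cost : (choice.2 <= 19 * c)%N.
Proof.
apply: leq_trans (_ : \sum_(l <- enum 'I_c) 19 <= _)%N; last first.
  by rewrite big_const_seq iter_addn_0 count_predT size_enum_ord.
(* Per attribute: 4 operations for [available], 10 for [gain] and at most 4 for the comparison; the
   turn itself makes 19. *)
apply: (@for_each_cost _ _ _ _ (fun=> 18%N)) => l best /=.
case: ifP => _ //=; case: best => [[b gb]|] //=.
Qed.

(** The 11 operations after the scan are 3 for [next_vector] and 8 for the updates. *)
Lemma body_cost : ((body sigma eta q tie Dhat st).2 <= 19 * c + 11)%N.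
Proof.
have := choose_attr_cost; rewrite /body /=.
by case: choice.1 => [[a g]|] /=; lia.
Qed.

End Choice.

(** * Welfare of the ranked prefixes returned by the oracle *)

Section Correctness.
Context {R : realType} {d c : nat}.
Local Notation vec := 'rV[R]_d.
Variables (sigma : vec -> vec -> R) (eta : R) (k : nat) (P : {fset vec}).
Variables (atb : vec -> {set 'I_c}) (q : vec).
Variables (ENN : {fset vec} -> vec -> seq vec).
Variables (tie : state R d c -> 'I_c -> 'I_c -> bool).
Hypothesis sigma_ge0 : forall x y, 0 <= sigma x y.
Hypothesis eta_gt0 : 0 < eta.
Hypothesis k_le_P : (k <= #|` P|)%N.
Hypothesis single : single_attribute P atb.
Hypothesis exact : exact_oracle sigma k ENN.

Local Notation D l := (attr_class P atb l).
Local Notation top l := (ENN (D l) q).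

Lemma in_attr_class v l : (v \in D l) = (v \in P) && (l \in atb v).
Proof. by rewrite !inE. Qed.

Lemma attr_class_disjoint v l l' : v \in D l -> v \in D l' -> l = l'.
Proof.
rewrite !in_attr_class => /andP[vP lv] /andP[_ l'v].
have /eqP/cards1P[a atbE] := single vP.
by move: lv l'v; rewrite atbE !inE => /eqP -> /eqP ->.
Qed.

(** Beyond [size (top l)] this is constant in [j], so increments are only considered below that
    size. *)
Definition prefix_welfare l j : R := \sum_(v <- take j (top l)) sigma q v + eta.

Definition log_welfare l j : R := ln (prefix_welfare l j).

Lemma prefix_welfare_gt0 l j : 0 < prefix_welfare l j.
Proof. by rewrite ltr_wpDl // sumr_ge0. Qed.

Lemma prefix_welfareS l j : (j < size (top l))%N ->
  prefix_welfare l j.+1 = prefix_welfare l j + sigma q (nth 0 (top l) j).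
Proof.
move=> lt_j; rewrite /prefix_welfare (take_nth 0 lt_j) -cats1 big_cat big_seq1.
by rewrite addrAC.
Qed.

Lemma top_antitone l i j : (i <= j)%N -> (j < size (top l))%N ->
  sigma q (nth 0 (top l) j) <= sigma q (nth 0 (top l) i).
Proof.
have [_ _ _ sorted_top _] := exact (D l) q; move=> le_ij lt_j.
have trans : transitive (fun x y => sigma q y <= sigma q x).
  by move=> y x z xy yz; apply: le_trans yz xy.
apply: (sorted_leq_nth trans _ 0 sorted_top) => //; rewrite inE //.
exact: leq_ltn_trans lt_j.
Qed.

Lemma log_welfare_concave l j : (j.+1 < size (top l))%N ->
  log_welfare l j.+2 - log_welfare l j.+1 <= log_welfare l j.+1 - log_welfare l j.
Proof.
move=> lt_j; rewrite /log_welfare !prefix_welfareS // ?(ltnW lt_j) //.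
by apply: ln_increment_le; rewrite ?prefix_welfare_gt0 ?top_antitone.
Qed.

Lemma log_welfare_increment_ge0 l j : (j < size (top l))%N ->
  0 <= log_welfare l j.+1 - log_welfare l j.
Proof.
move=> lt_j; rewrite subr_ge0 ler_ln ?posrE ?prefix_welfare_gt0 //.
by rewrite prefix_welfareS // lerDl.
Qed.

(** Keeps the counts of any competitor within the range where [log_welfare] is known to be
    concave. *)
Lemma card_class_le_top (S : {fset vec}) l : S `<=` P -> (#|` S| <= k)%N ->
  (#|` S `&` D l| <= size (top l))%N.
Proof.
have [_ _ -> _ _] := exact (D l) q => SP Sk.
rewrite leq_min fsubset_leq_card ?fsubsetIr // andbT.
by apply: leq_trans Sk; apply: fsubset_leq_card; apply: fsubsetIl.
Qed.

Lemma utility_le_prefix (S : {fset vec}) l : S `<=` P -> (#|` S| <= k)%N ->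
  utility sigma P atb q S l + eta <= prefix_welfare l #|` S `&` D l|.
Proof.
move=> SP Sk; rewrite lerD2r /utility.
have le_top := card_class_le_top l SP Sk.
have [uniq_top _ _ _ beyond] := exact (D l) q.
case cardE : #|` S `&` D l| le_top => [|m] lt_m.
  by rewrite (cardfs0_eq cardE) take0 big_seq_fset0.
(* The threshold is the similarity of the last vector in the prefix of length [m.+1]; the empty
   prefix has none and was treated apart. A vector outside the prefix either ranks later in the
   answer or was left out by the oracle. *)
apply: (@ler_sum_threshold _ _ _ _ _ (sigma q (nth 0 (top l) m))).
- exact: fset_uniq.
- exact: take_uniq.
- by rewrite size_takel.
- move=> v v_take; have v_top := mem_take v_take.
  rewrite in_take // ltnS in v_take.
  by rewrite -[v](nth_index 0 v_top) top_antitone.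
- move=> v; rewrite in_fsetI => /andP[_ vD].
  have [v_top|/beyond] := boolP (v \in top l); last first.
    by move=> le_v _; apply: le_v; rewrite ?mem_nth.
  rewrite in_take // -leqNgt => lt_v.
  by rewrite -[v](nth_index 0 v_top) top_antitone ?index_mem // ltnW.
Qed.

(** * The greedy invariant and its optimality *)

(** [inv_price] is the optimality certificate: [z] acts as a Lagrange multiplier for the constraint
    that the counts sum to [k], one value serving all attributes. An attribute with no pick has no
    last gain, and an exhausted one has no next gain. *)
Record greedy_invariant (st : state R d c) : Prop := GreedyInvariant {
  inv_sub : alg st `<=` P;
  inv_prefix : forall l, alg st `&` D l =i take (cnt st l) (top l);
  inv_cnt : forall l, (cnt st l <= size (top l))%N;
  inv_wel : forall l, wel st l + eta = prefix_welfare l (cnt st l);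
  inv_price : exists z, forall l,
    ((0 < cnt st l)%N ->
       z <= log_welfare l (cnt st l) - log_welfare l (cnt st l).-1) /\
    ((cnt st l < size (top l))%N ->
       log_welfare l (cnt st l).+1 - log_welfare l (cnt st l) <= z)
}.

Lemma card_prefix st l : greedy_invariant st ->
  #|` alg st `&` D l| = cnt st l.
Proof.
move=> inv; have [uniq_top _ _ _ _] := exact (D l) q.
rewrite -(size_takel (inv_cnt inv l)); apply: perm_size.
by apply: uniq_perm; rewrite ?fset_uniq ?take_uniq //; apply: inv_prefix.
Qed.

Lemma card_alg st : greedy_invariant st ->
  #|` alg st| = (\sum_(l < c) cnt st l)%N.
Proof.
move=> inv; rewrite (card_attr_classes single (inv_sub inv)).
by apply: eq_bigr => l _; apply: card_prefix.
Qed.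

Lemma greedy_invariant_optimal st : greedy_invariant st -> #|` alg st| = k ->
  in_argmax k P (NSW sigma eta P atb q) (alg st).
Proof.
move=> inv card_k; split=> // [|S SP Sk]; first exact: inv_sub.
have utilE l : utility sigma P atb q (alg st) l + eta
             = prefix_welfare l (cnt st l).
  have [uniq_top _ _ _ _] := exact (D l) q.
  congr (_ + _); apply: perm_big.
  by apply: uniq_perm; rewrite ?fset_uniq ?take_uniq //; apply: inv_prefix.
have util_gt0 T l : 0 < utility sigma P atb q T l + eta.
  by rewrite ltr_wpDl // sumr_ge0.
have prod_ge0 T : 0 <= \prod_(l < c) (utility sigma P atb q T l + eta).
  by apply: prodr_ge0 => l _; apply: ltW.
(* The root is monotone on nonnegative reals, so the products are compared; they become sums of
   logarithms once each factor is replaced by a prefix welfare. *)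
apply: ge0_ler_powR; rewrite ?nnegrE ?invr_ge0 //.
under [leRHS]eq_bigr do rewrite utilE.
apply: le_trans (_ : \prod_(l < c) prefix_welfare l #|` S `&` D l| <= _).
  apply: ler_prod => l _.
  by rewrite ltW //= utility_le_prefix ?Sk.
have expE l j : prefix_welfare l j = expR (log_welfare l j).
  by rewrite lnK // posrE prefix_welfare_gt0.
rewrite !(eq_bigr _ (fun l _ => expE l _)).
rewrite -!expR_sum ler_expR -subr_le0 -sumrB.
have [z price] := inv_price inv.
apply: le_trans (_ : \sum_(l < c) (z *+ #|` S `&` D l| - z *+ cnt st l) <= _).
  apply: ler_sum => l _; have [zi iz] := price l.
  apply: (increment_threshold (@log_welfare_concave l)) => //.
    exact: inv_cnt.
  by apply: card_class_le_top; rewrite ?Sk.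
rewrite sumrB !sumrMnr -card_attr_classes // -card_alg // Sk card_k.
by rewrite subrr.
Qed.

(** * The loop: progress, preservation of the invariant, termination and cost *)

Variable Dhat : {ffun 'I_c -> seq vec}.
Hypothesis DhatE : forall l, Dhat l = top l.

(** If all lists were exhausted, each count would be [minn k #|] D l|[. Fewer than]k[picks in total
    force the minimum to be the class size, so all of]P[would be selected, against]k <= #|[P|]. *)
Lemma exists_available st : greedy_invariant st -> (#|` alg st| < k)%N ->
  exists l, (cnt st l < size (top l))%N.
Proof.
move=> inv lt_k; apply/existsP; rewrite -[X in is_true X]negbK negb_exists.
apply/forallP => full.
have cntE l : cnt st l = minn k #|` D l|.
  have [_ _ <- _ _] := exact (D l) q.
  by apply/eqP; rewrite eqn_leq inv_cnt //= leqNgt full.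
have lt_cnt l : (cnt st l < k)%N.
  by apply: leq_ltn_trans lt_k; rewrite card_alg // (bigD1 l) //= leq_addr.
suff : (#|` P| <= #|` alg st|)%N by lia.
rewrite card_alg // (card_attr_classes single (fsubset_refl P)).
apply: leq_sum => l _; have := lt_cnt l; rewrite cntE => lt_min.
have /fsetIidPr -> : D l `<=` P by apply/fsubsetP => v; rewrite in_attr_class => /andP[].
by move: lt_min; lia.
Qed.

Lemma greedy_step st : greedy_invariant st -> (#|` alg st| < k)%N ->
  let st' := (body sigma eta q tie Dhat st).1 in
  greedy_invariant st' /\ #|` alg st'| = #|` alg st|.+1.
Proof.
move=> inv lt_k.
have gainE l : (cnt st l < size (top l))%N ->
    (gain sigma eta q Dhat st l).1 =
    log_welfare l (cnt st l).+1 - log_welfare l (cnt st l).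
  by move=> lt_l; rewrite /= DhatE inv_wel // -prefix_welfareS.
have := choose_attr_spec sigma eta q tie Dhat st; rewrite /body /=.
case: (choose_attr _ _ _ _ _ _).1 => [[a g] [ok best]|none]; last first.
  by have [l lt_l] := exists_available inv lt_k; move: (none l); rewrite /= DhatE lt_l.
rewrite /= DhatE; rewrite DhatE in ok.
have max_a l : (cnt st l < size (top l))%N ->
    log_welfare l (cnt st l).+1 - log_welfare l (cnt st l) <=
    log_welfare a (cnt st a).+1 - log_welfare a (cnt st a).
  by move=> lt_l; rewrite -!gainE //; apply: best; rewrite DhatE.
have [uniq_top sub_top _ _ _] := exact (D a) q.
set v := nth 0 (top a) (cnt st a).
have v_top : v \in top a by rewrite mem_nth.
have vD : v \in D a := sub_top _ v_top.
(* A selected vector of [D a] has rank below [cnt st a], whereas [v] has exactly that rank. *)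
have v_new : v \notin alg st.
  apply/negP => v_alg; have := inv_prefix inv a v.
  by rewrite in_fsetI v_alg vD in_take // index_uniq // ltnn.
split; last by rewrite cardfsU1 v_new.
split=> /=.
- rewrite fsubUset fsub1set inv_sub // andbT.
  by move: vD; rewrite in_attr_class => /andP[].
- move=> l w; rewrite ffunE in_fsetI in_fset1U.
  have [->|ne_la] := eqVneq l a.
    rewrite (take_nth 0) // mem_rcons inE -inv_prefix // in_fsetI.
    by have [->|//] := eqVneq w v; rewrite vD.
  rewrite -inv_prefix // in_fsetI; have [->|//] := eqVneq w v.
  rewrite (negPf v_new) /=; apply/negP => /(attr_class_disjoint vD) al.
  by rewrite al eqxx in ne_la.
- by move=> l; rewrite ffunE; have [->|_] := eqVneq l a => //; apply: inv_cnt.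
- move=> l; rewrite !ffunE; have [->|_] := eqVneq l a; last exact: inv_wel.
  by rewrite prefix_welfareS // -inv_wel // addrAC.
(* The new price is the gain just realized. For [a] it equals the last gain, and concavity bounds
   the next one. For other attributes, last gains are at least the old price, which is at least this
   gain, and next gains are bounded by the maximality of [a]. *)
- exists (log_welfare a (cnt st a).+1 - log_welfare a (cnt st a)) => l.
  have [z price] := inv_price inv.
  rewrite ffunE; have [->|_] := eqVneq l a.
    by split=> // lt_a; apply: log_welfare_concave.
  split=> [cnt_gt0|]; last exact: max_a.
  exact: le_trans ((price a).2 ok) ((price l).1 cnt_gt0).
Qed.

Lemma greedy_invariant_init : greedy_invariant (init (R := R) (d := d) (c := c)).1.
Proof.
split=> /=.
- exact: fsub0set.
- by move=> l v; rewrite ffunE take0 fset0I !inE.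
- by move=> l; rewrite ffunE.
- by move=> l; rewrite !ffunE /prefix_welfare take0 big_nil.
(* With no picks, a price only has to dominate every first gain; these are nonnegative, so their sum
   does. Empty classes contribute 0. *)
- pose z l := if (0 < size (top l))%N then log_welfare l 1 - log_welfare l 0 else 0.
  have z_ge0 l : 0 <= z l.
    by rewrite /z; case: ifP => // lt_l; apply: log_welfare_increment_ge0.
  exists (\sum_(l < c) z l) => l; rewrite ffunE; split=> // lt_l.
  by rewrite (bigD1 l) //= {1}/z lt_l lerDl sumr_ge0.
Qed.

Lemma loop_terminates st : greedy_invariant st -> (#|` alg st| <= k)%N ->
  exists st' t, while_run (guard k) (body sigma eta q tie Dhat) st st' t.
Proof.
(* Induction on a bound for the number of missing vectors, which each turn lowers by one. *)
move: {2}(k - _)%N (leqnn (k - #|` alg st|)%N) => n.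
elim: n st => [|n IH] st le_n inv le_k.
  exists st, (guard k st).2; apply: While_stop => /=.
  by apply/negbTE; rewrite -leqNgt -subn_eq0 -leqn0.
have [lt_k|ge_k] := ltnP #|` alg st| k; last first.
  exists st, (guard k st).2; apply: While_stop => /=.
  by apply/negbTE; rewrite -leqNgt.
have [inv' card'] := greedy_step inv lt_k.
have [||st' [t run]] := IH _ _ inv'; rewrite ?card' //; first by lia.
exists st', ((guard k st).2 + (body sigma eta q tie Dhat st).2 + t)%N.
by apply: While_step.
Qed.

(** Each turn costs at most [19 * c + 11] for the body and 2 for the guard; the final 2 is the
    failing guard. *)
Lemma loop_correct st st' t :
  while_run (guard k) (body sigma eta q tie Dhat) st st' t ->
  greedy_invariant st -> (#|` alg st| <= k)%N ->
  [/\ greedy_invariant st', #|` alg st'| = k &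
      (t <= (k - #|` alg st|) * (19 * c + 13) + 2)%N].
Proof.
elim=> {st st' t} [st|st st' t].
  move=> /= /negbT; rewrite -leqNgt => ge_k inv le_k.
  by split=> //; [lia | rewrite addnC leq_addr].
move=> lt_k _ IH inv _; have {}lt_k : (#|` alg st| < k)%N := lt_k.
have [inv' card'] := greedy_step inv lt_k.
have [|inv_end card_end le_t] := IH inv'; rewrite ?card' //.
split=> //; have := body_cost sigma eta q tie Dhat st.
rewrite (_ : (guard k st).2 = 2)%N // -(subnSK lt_k) mulSn.
by rewrite card' in le_t; lia.
Qed.

End Correctness.

(** * The fetching step and the final bound *)

Lemma fetch_value (R : realType) (d c : nat) (P : {fset 'rV[R]_d})
    (atb : 'rV[R]_d -> {set 'I_c}) (q : 'rV[R]_d)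
    (ENN : {fset 'rV[R]_d} -> 'rV[R]_d -> seq 'rV[R]_d)
    (tENN : {fset 'rV[R]_d} -> 'rV[R]_d -> nat) (l : 'I_c) :
  (fetch P atb q ENN tENN).1 l = ENN (attr_class P atb l) q.
Proof. by rewrite /fetch /= for_each_value /= foldl_upd mem_enum. Qed.

(** Besides the oracle calls, [c] operations allocate the table, and each attribute pays one for the
    turn and one for the store. *)
Lemma fetch_cost (R : realType) (d c : nat) (P : {fset 'rV[R]_d})
    (atb : 'rV[R]_d -> {set 'I_c}) (q : 'rV[R]_d)
    (ENN : {fset 'rV[R]_d} -> 'rV[R]_d -> seq 'rV[R]_d)
    (tENN : {fset 'rV[R]_d} -> 'rV[R]_d -> nat) :
  ((fetch P atb q ENN tENN).2 <=
     3 * c + \sum_(l < c) tENN (attr_class P atb l) q)%N.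
Proof.
rewrite /fetch /=.
have cost l (a : {ffun 'I_c -> seq 'rV[R]_d}) :
    ((let! s := oracle_call q ENN tENN (attr_class P atb l) in tick (upd a l s)).2
       <= (tENN (attr_class P atb l) q).+1)%N by rewrite /= addn1.
have := for_each_cost (enum 'I_c) [ffun=> [::]] cost.
rewrite big_enum /=.
under eq_bigr do rewrite -addn2.
rewrite big_split /= sum_nat_const card_ord (eq_bigl xpredT) //; lia.
Qed.

Theorem theorem1 :
  exists C : nat,
  forall (R : realType) (d c k : nat) (P : {fset 'rV[R]_d})
    (sigma : 'rV[R]_d -> 'rV[R]_d -> R) (atb : 'rV[R]_d -> {set 'I_c})
    (eta : R) (q : 'rV[R]_d)
    (ENN : {fset 'rV[R]_d} -> 'rV[R]_d -> seq 'rV[R]_d)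
    (tENN : {fset 'rV[R]_d} -> 'rV[R]_d -> nat)
    (tie : state R d c -> 'I_c -> 'I_c -> bool),
    (forall x y, 0 <= sigma x y) ->
    0 < eta ->
    (0 < k)%N ->
    (k <= #|` P|)%N ->
    single_attribute P atb ->
    exact_oracle sigma k ENN ->
    (exists (A : {fset 'rV[R]_d}) (t : nat),
       nash_ann sigma eta k P atb q ENN tENN tie A t) /\
    (forall (A : {fset 'rV[R]_d}) (t : nat),
       nash_ann sigma eta k P atb q ENN tENN tie A t ->
       in_argmax k P (NSW sigma eta P atb q) A /\
       (t <= C * (k * c) + \sum_(l < c) tENN (attr_class P atb l) q)%N).
Proof.
(* Apart from the oracle the total is at most [3c + (1 + 2c) + k (19c + 13) + 2]. Since [k] and [c]
   are at least 1, every term is absorbed into [k c], with coefficient 5 + 3 + 19 + 13 = 40. *)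
exists 40%N => R d c k P sigma atb eta q ENN tENN tie.
move=> sigma_ge0 eta_gt0 k_gt0 k_le_P single exact.
have DhatE := fetch_value P atb q ENN tENN.
have inv0 : greedy_invariant sigma eta P atb q ENN init.1.
  exact: greedy_invariant_init.
have card0 : #|` alg (@init R d c).1| = 0%N by exact: cardfs0.
have le0 : (#|` alg (@init R d c).1| <= k)%N by rewrite card0.
split.
  have [st [t run]] := loop_terminates tie sigma_ge0 eta_gt0 k_le_P single
    exact DhatE inv0 le0.
  by exists (alg st), ((fetch P atb q ENN tENN).2 + (@init R d c).2 + t)%N, st, t.
move=> A t [st [t' [run -> ->]]].
have [inv card_k le_t] := loop_correct sigma_ge0 eta_gt0 k_le_P
  single exact DhatE run inv0 le0.
split; first exact: greedy_invariant_optimal.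
(* Without attributes the returned set would be empty, although it has [k > 0] elements. *)
have c_gt0 : (0 < c)%N.
  rewrite lt0n; apply/eqP => c0; have no_attr (l : 'I_c) : False.
    by case: l => m; rewrite c0.
  by rewrite -card_k (card_alg single exact inv) big1 in k_gt0 => // l.
have := fetch_cost P atb q ENN tENN; move: le_t; rewrite card0 subn0.
rewrite (_ : init.2 = (1 + (c + (c + 0)))%N) //.
by nia.
Qed.
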